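(* Let $k$ be a field, let $D$ be an oriented knot diagram with at least one crossing, and let $\tau : (Q_D)_0 \to k\setminus\{0\}$ be a map. Then the algebra of the diagram $\Lambda_{D,\tau}=kQ_D/I_\tau$ is special biserial, and the monomial algebra of the diagram $\Xi_D=kQ_D/J_D$ is special biserial. That is: $(Q_D,\rho)$ is special biserial when $\rho$ is the set of relations of types I and II generating $I_\tau$, and also when $\rho$ is the set of relations of types I and II$'$ generating $J_D$.
   Context: Quivers and path algebras. A quiver $Q$ consists of finite sets $Q_0$ (vertices) and $Q_1$ (arrows) and maps $s,t:Q_1\to Q_0$ (source, target); loops and multiple arrows are allowed. The path algebra $kQ$ has as $k$-basis all oriented paths of $Q$, including the trivial (length $0$) paths given by the vertices; the product of two paths is their concatenation if it can be performed and $0$ otherwise. Paths are composed from right to left: $ba$ means first $a$, then $b$, with $t(a)=s(b)$. Let $F$ be the two-sided ideal of $kQ$ generated by the arrows; a two-sided ideal $I$ is admissible if $F^n\subseteq I\subseteq F^2$ for some positive integer $n$. Special biserial. Let $Q$ be a quiver and $I$ an admissible two-sided ideal of $kQ$ generated by a set of relations $\rho$. Then $(Q,\rho)$ (and the algebra $kQ/I$) is called special biserial if: (1) any vertex of $Q$ is the source of at most two arrows and the target of at most two arrows; (2) if two different arrows $c$ and $d$ start at the target of an arrow $a$, then at least one of the paths $ca$, $da$ is in $\rho$; (3) if two different arrows $a$ and $b$ end at the source of an arrow $c$, then at least one of the paths $ca$, $cb$ is in $\rho$. Knot diagrams. An oriented knot diagram $D$ is a regular projection of an oriented knot (one component) to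 the plane, with finitely many transversal double points (crossings), each with the information of which strand passes over and which passes under. Thus travelling once around $D$ along its orientation, one passes through each crossing exactly twice, once over and once under. A segment of $D$ is the part of the diagram followed, along the orientation, from one passage through a crossing to the next passage through a crossing (no crossing in between). The quiver $Q_D$ ($D$ with at least one crossing). Its vertices are the crossings of $D$. Each segment gives one arrow, from the crossing where the segment starts to the crossing where it ends. The source of an arrow is called positive (resp. negative) if the corresponding segment starts by over-crossing (resp. under-crossing) at that crossing; the target of an arrow is called positive (resp. negative) if the segment ends by over-crossing (resp. under-crossing). Let $n_D$ be the number of arrows of $Q_D$. Cycles at a vertex $e$. $\alpha_e$ is the path from $e$ to $e$ that starts with the arrow with positive source $e$ and continues by browsing the oriented diagram (each arrow followed by the arrow of the next segment along the diagram) until reaching the arrow with negative target $e$. $\beta_e$ is the path from $e$ to $e$ that starts with the arrow with negative source $e$ and continues by browsing the oriented diagram until reaching the arrow with positive target $e$. Relations. Type I: all paths $ba$ of length $2$ in $Q_D$ such that, at the middle vertex $e=t(a)=s(b)$, the sign of the target of $a$ differs from the sign of the source of $b$. Type II: the elements $\alpha_e\beta_e-\tau(e)\,\beta_e\alpha_e$ for all vertices $e$. Type II$'$: all paths of length $n_D+1$ in $Q_D$. The ideal $I_\tau$ is the two-sided ideal of $kQ_D$ generated by the relations of types I and II, and $J_D$ is the two-sided ideal generated by the relations of types I and II$'$. *)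

(* Defs.v *)
From HB Require Import structures.
From mathcomp Require Import all_boot all_order all_algebra.
From mathcomp Require Import finmap.
From mathcomp Require Import all_classical all_reals all_analysis.
(* The notations of monalg are incompatible with those of analysis. *)
From mathcomp Require Import -(notations) monalg.

Set Implicit Arguments.
Unset Strict Implicit.
Unset Printing Implicit Defensive.

Import Order.TTheory GRing.Theory Num.Theory numFieldNormedType.Exports.

Local Open Scope classical_set_scope.
Local Open Scope ring_scope.

(** * Quivers and path algebras *)

Record quiver := Quiver {
  vertex : finType;
  arrow : finType;
  src : arrow -> vertex;
  tgt : arrow -> vertex }.

Section PathAlgebra.
Variable Q : quiver.

(* Arrows are listed in the order in which they are travelled, so that the path
   written [b a] in right-to-left notation is the list [:: a; b]. *)
Fixpoint composable (v : vertex Q) (s : seq (arrow Q)) : bool :=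
  if s is a :: s' then (src a == v) && composable (tgt a) s' else true.

Definition endpoint (v : vertex Q) (s : seq (arrow Q)) : vertex Q :=
  last v (map (@tgt Q) s).

(* The source is recorded in order to distinguish the trivial paths. *)
Record qpath := QPath {
  qpath_val : vertex Q * seq (arrow Q);
  _ : composable qpath_val.1 qpath_val.2 }.

HB.instance Definition _ := [isSub for qpath_val].
HB.instance Definition _ := [Choice of qpath by <:].

Definition path_src (p : qpath) : vertex Q := (val p).1.
Definition path_arrows (p : qpath) : seq (arrow Q) := (val p).2.
Definition path_tgt (p : qpath) : vertex Q :=
  endpoint (path_src p) (path_arrows p).
Definition path_length (p : qpath) : nat := size (path_arrows p).

Variable k : fieldType.

Definition path_algebra : Type := malg qpath k.

HB.instance Definition _ := GRing.Lmodule.on path_algebra.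

Definition path_elt (p : qpath) : path_algebra := mkmalgU p 1.

(* The path with source [v] and list of arrows [s], or 0 if there is none. *)
Definition walk_elt (v : vertex Q) (s : seq (arrow Q)) : path_algebra :=
  if insub (v, s) is Some p then path_elt p else 0.

Definition trivial_elt (v : vertex Q) : path_algebra := walk_elt v [::].
Definition arrow_elt (a : arrow Q) : path_algebra := walk_elt (src a) [:: a].

Definition path_mul (p q : qpath) : path_algebra :=
  if path_tgt q == path_src p
  then walk_elt (path_src q) (path_arrows q ++ path_arrows p) else 0.

Definition pa_one : path_algebra := \sum_(v : vertex Q) trivial_elt v.

Definition pa_mul (x y : path_algebra) : path_algebra :=
  \sum_(p <- msupp x) \sum_(q <- msupp y) (mcoeff p x * mcoeff q y) *: path_mul p q.

Implicit Types (x y z : path_algebra) (p q r : qpath).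

Lemma malg_scaleU (c : k) p : mkmalgU p c = c *: path_elt p :> path_algebra.
Proof.
by apply/malgP => q; rewrite mcoeffZ !mcoeffU; case: eqP; rewrite ?mulr1 ?mulr0.
Qed.

Lemma pa_expand x : x = \sum_(p <- msupp x) mcoeff p x *: path_elt p.
Proof. by rewrite {1}[x]monalgE; apply: eq_bigr => p _; rewrite malg_scaleU. Qed.

Lemma composable_cat v s1 s2 : composable v (s1 ++ s2) =
  composable v s1 && composable (endpoint v s1) s2.
Proof.
elim: s1 v => [//|a s1 IH] v /=.
by rewrite IH andbA.
Qed.

Lemma endpoint_cat v s1 s2 : endpoint v (s1 ++ s2) = endpoint (endpoint v s1) s2.
Proof. by rewrite /endpoint map_cat last_cat. Qed.

Lemma walk_eltE v s (h : composable v s) :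
  walk_elt v s = path_elt (@QPath (v, s) h).
Proof. by rewrite /walk_elt insubT. Qed.

Lemma path_mulE p q (h : path_tgt q = path_src p) :
  exists r, [/\ path_mul p q = path_elt r, path_src r = path_src q,
    path_tgt r = path_tgt p & path_arrows r = path_arrows q ++ path_arrows p].
Proof.
have hc : composable (path_src q) (path_arrows q ++ path_arrows p).
  rewrite composable_cat (valP q) /= -/(path_tgt q) h; exact: (valP p).
exists (@QPath (path_src q, path_arrows q ++ path_arrows p) hc).
rewrite /path_mul h eqxx walk_eltE; split=> //.
by rewrite /path_tgt /path_src /path_arrows /= endpoint_cat -/(path_tgt q) h.
Qed.

Lemma pa_mulw (d1 d2 : {fset qpath}) x y :
  (msupp x `<=` d1)%fset -> (msupp y `<=` d2)%fset ->
  pa_mul x y = \sum_(p <- d1) \sum_(q <- d2) (mcoeff p x * mcoeff q y) *: path_mul p q.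
Proof.
move=> h1 h2; rewrite /pa_mul (big_fset_incl _ h1) /=; last first.
  move=> p _ /mcoeff_outdom xp; rewrite big1 // => q _.
  by rewrite xp mul0r scale0r.
apply: eq_bigr => p _; apply: big_fset_incl => // q _ /mcoeff_outdom ->.
by rewrite mulr0 scale0r.
Qed.

Lemma pa_mulDl : left_distributive pa_mul +%R.
Proof.
move=> x y z.
rewrite (pa_mulw (msuppD_le x y) (fsubset_refl _)).
rewrite (pa_mulw (fsubsetUl _ (msupp y)) (fsubset_refl (msupp z))).
rewrite (pa_mulw (fsubsetUr (msupp x) _) (fsubset_refl (msupp z))).
rewrite -big_split /=; apply: eq_bigr => p _.
rewrite -big_split /=; apply: eq_bigr => q _.
by rewrite mcoeffD mulrDl scalerDl.
Qed.

Lemma pa_mulDr : right_distributive pa_mul +%R.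
Proof.
move=> x y z.
rewrite (pa_mulw (fsubset_refl _) (msuppD_le y z)).
rewrite (pa_mulw (fsubset_refl (msupp x)) (fsubsetUl _ (msupp z))).
rewrite (pa_mulw (fsubset_refl (msupp x)) (fsubsetUr (msupp y) _)).
rewrite -big_split /=; apply: eq_bigr => p _.
rewrite -big_split /=; apply: eq_bigr => q _.
by rewrite mcoeffD mulrDr scalerDl.
Qed.

Lemma pa_mulZl c x y : c *: pa_mul x y = pa_mul (c *: x) y.
Proof.
rewrite (pa_mulw (msuppZ_le c x) (fsubset_refl _)) /pa_mul scaler_sumr.
apply: eq_bigr => p _; rewrite scaler_sumr; apply: eq_bigr => q _.
by rewrite mcoeffZ scalerA mulrA.
Qed.

Lemma pa_mulZr c x y : c *: pa_mul x y = pa_mul x (c *: y).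
Proof.
rewrite (pa_mulw (fsubset_refl _) (msuppZ_le c y)) /pa_mul scaler_sumr.
apply: eq_bigr => p _; rewrite scaler_sumr; apply: eq_bigr => q _.
by rewrite mcoeffZ scalerA mulrCA.
Qed.

Lemma pa_mulUU p q : pa_mul (path_elt p) (path_elt q) = path_mul p q.
Proof.
rewrite (pa_mulw msuppU_le msuppU_le) !big_seq_fset1 !mcoeffUU.
by rewrite mulr1 scale1r.
Qed.

Lemma pa_mul0l y : pa_mul 0 y = 0.
Proof. by apply: (addIr (pa_mul 0 y)); rewrite -pa_mulDl !add0r. Qed.

Lemma pa_mul0r x : pa_mul x 0 = 0.
Proof. by apply: (addIr (pa_mul x 0)); rewrite -pa_mulDr !add0r. Qed.

Lemma pa_mul_suml (I : Type) (s : seq I) (F : I -> path_algebra) y :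
  pa_mul (\sum_(i <- s) F i) y = \sum_(i <- s) pa_mul (F i) y.
Proof.
exact: (big_morph (pa_mul^~ y) (fun a b => pa_mulDl a b y) (pa_mul0l y)).
Qed.

Lemma pa_mul_sumr (I : Type) (s : seq I) (F : I -> path_algebra) x :
  pa_mul x (\sum_(i <- s) F i) = \sum_(i <- s) pa_mul x (F i).
Proof. exact: (big_morph (pa_mul x) (pa_mulDr x) (pa_mul0r x)). Qed.

Lemma path_mulA p q r :
  pa_mul (path_elt p) (path_mul q r) = pa_mul (path_mul p q) (path_elt r).
Proof.
have [hqr|hqr] := eqVneq (path_tgt r) (path_src q); last first.
  rewrite {1}/path_mul (negbTE hqr) pa_mul0r.
  have [hpq|hpq] := eqVneq (path_tgt q) (path_src p).
    have [u [-> hs _ _]] := path_mulE hpq.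
    by rewrite pa_mulUU /path_mul hs (negbTE hqr).
  by rewrite /path_mul (negbTE hpq) pa_mul0l.
have [u [-> us ut ua]] := path_mulE hqr; rewrite pa_mulUU.
have [hpq|hpq] := eqVneq (path_tgt q) (path_src p); last first.
  by rewrite /path_mul ut (negbTE hpq) pa_mul0l.
have [w [-> ws wt wa]] := path_mulE hpq; rewrite pa_mulUU.
by rewrite /path_mul ut hpq eqxx ws hqr eqxx us ua wa catA.
Qed.

Lemma pa_ind (P : path_algebra -> Prop) :
  P 0 -> (forall x y, P x -> P y -> P (x + y)) ->
  (forall c x, P x -> P (c *: x)) -> (forall p, P (path_elt p)) ->
  forall x, P x.
Proof.
move=> P0 PD PZ Pp x; rewrite [x]pa_expand.
by apply: (big_ind P) => // p _; apply: PZ.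
Qed.

Lemma pa_mulA : associative pa_mul.
Proof.
move=> x y z; elim/pa_ind: x => [|x1 x2 h1 h2|c x h|p].
- by rewrite !pa_mul0l.
- by rewrite !pa_mulDl h1 h2.
- by rewrite -!pa_mulZl h.
elim/pa_ind: y => [|y1 y2 h1 h2|c y h|q].
- by rewrite pa_mul0l !pa_mul0r pa_mul0l.
- by rewrite pa_mulDl !pa_mulDr pa_mulDl h1 h2.
- by rewrite -pa_mulZl -!pa_mulZr -pa_mulZl h.
elim/pa_ind: z => [|z1 z2 h1 h2|c z h|r].
- by rewrite !pa_mul0r.
- by rewrite !pa_mulDr h1 h2.
- by rewrite -!pa_mulZr h.
by rewrite !pa_mulUU path_mulA.
Qed.

Lemma trivial_mull v p :
  pa_mul (trivial_elt v) (path_elt p) = if path_tgt p == v then path_elt p else 0.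
Proof.
rewrite /trivial_elt (walk_eltE (isT : composable v [::])) pa_mulUU /path_mul.
rewrite {1}/path_src /= {2}/path_arrows /= cats0.
by case: eqP => // _; rewrite /walk_elt -surjective_pairing valK.
Qed.

Lemma trivial_mulr v p :
  pa_mul (path_elt p) (trivial_elt v) = if path_src p == v then path_elt p else 0.
Proof.
rewrite /trivial_elt (walk_eltE (isT : composable v [::])) pa_mulUU /path_mul.
rewrite /path_tgt {1 3}/path_src {1 2}/path_arrows /= /endpoint /= eq_sym.
by case: eqP => // <-; rewrite /walk_elt -surjective_pairing valK.
Qed.

Lemma pa_mul1l : left_id pa_one pa_mul.
Proof.
elim/pa_ind => [|x y hx hy|c x h|p]; first exact: pa_mul0r.
- by rewrite pa_mulDr hx hy.
- by rewrite -pa_mulZr h.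
rewrite /pa_one pa_mul_suml (bigD1 (path_tgt p)) //=.
rewrite trivial_mull eqxx big1 ?addr0 // => v.
by rewrite trivial_mull eq_sym => /negbTE ->.
Qed.

Lemma pa_mul1r : right_id pa_one pa_mul.
Proof.
elim/pa_ind => [|x y hx hy|c x h|p]; first exact: pa_mul0l.
- by rewrite pa_mulDl hx hy.
- by rewrite -pa_mulZl h.
rewrite /pa_one pa_mul_sumr (bigD1 (path_src p)) //=.
rewrite trivial_mulr eqxx big1 ?addr0 // => v.
by rewrite trivial_mulr eq_sym => /negbTE ->.
Qed.

HB.instance Definition _ := GRing.Zmodule_isPzRing.Build path_algebra
  pa_mulA pa_mul1l pa_mul1r pa_mulDl pa_mulDr.
End PathAlgebra.

(** * Ideals and special biserial pairs *)

Section Ideals.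
Variable A : pzRingType.

Record two_sided_ideal (I : set A) : Prop := TwoSidedIdeal {
  ideal0 : I 0;
  idealD : forall x y, I x -> I y -> I (x + y);
  idealMl : forall a x, I x -> I (a * x);
  idealMr : forall a x, I x -> I (x * a) }.

Definition ideal_gen (S : set A) : set A := smallest two_sided_ideal S.

Definition ideal_mul (I J : set A) : set A :=
  ideal_gen [set z | exists x y, [/\ I x, J y & z = x * y]].

Definition ideal_pow (I : set A) (n : nat) : set A :=
  iter n (ideal_mul I) setT.

End Ideals.

Section SpecialBiserial.
Variables (k : fieldType) (Q : quiver).

Local Notation kQ := (path_algebra Q k).

Definition arrow_ideal : set kQ := ideal_gen (range (@arrow_elt Q k)).

Definition admissible (I : set kQ) : Prop :=
  two_sided_ideal I /\
  exists n, [/\ (0 < n)%N, ideal_pow arrow_ideal n `<=` I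
                & I `<=` ideal_pow arrow_ideal 2].

Record special_biserial (rho : set kQ) : Prop := SpecialBiserial {
  sb_admissible : admissible (ideal_gen rho);
  sb_source : forall v : vertex Q, (#|[pred a : arrow Q | src a == v]| <= 2)%N;
  sb_target : forall v : vertex Q, (#|[pred a : arrow Q | tgt a == v]| <= 2)%N;
  sb_succ : forall a c d : arrow Q, c != d -> src c = tgt a -> src d = tgt a ->
    rho (arrow_elt k c * arrow_elt k a) \/ rho (arrow_elt k d * arrow_elt k a);
  sb_pred : forall a b c : arrow Q, a != b -> tgt a = src c -> tgt b = src c ->
    rho (arrow_elt k c * arrow_elt k a) \/ rho (arrow_elt k c * arrow_elt k b) }.

End SpecialBiserial.

(** * Oriented knot diagrams *)

Section KnotDiagram.
Variable R : realType.

Definition double_points (gamma : R -> R * R) : set (R * R) :=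
  [set c | exists s t : R, [/\ 0 <= s < 1, 0 <= t < 1, s <> t,
                           gamma s = c & gamma t = c]].

Definition transversal (u v : R * R) : Prop := u.1 * v.2 - u.2 * v.1 != 0.

(* A knot in 3-space, given by a 1-periodic parametrization whose direction is
   the orientation, is split into its projection [shadow] to the plane and its
   [height] above the plane; the projection is regular.  Differentiability is
   required only at the crossings, so that smooth as well as polygonal knots
   (with no vertex projected to a crossing) are allowed. *)
Record knot_diagram := KnotDiagram {
  shadow : R -> R * R;
  height : R -> R;
  shadow_continuous : continuous shadow;
  height_continuous : continuous height;
  shadow_periodic : forall t : R, shadow (t + 1) = shadow t;
  height_periodic : forall t : R, height (t + 1) = height t;
  knot_embedded : forall s t : R, 0 <= s < 1 -> 0 <= t < 1 ->
    shadow s = shadow t -> height s = height t -> s = t;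
  finite_double_points : finite_set (double_points shadow);
  no_triple_point : forall r s t : R, 0 <= r < 1 -> 0 <= s < 1 -> 0 <= t < 1 ->
    shadow r = shadow s -> shadow s = shadow t -> [\/ r = s, s = t | r = t];
  crossing_derivable : forall t : R, 0 <= t < 1 ->
    double_points shadow (shadow t) -> derivable shadow t 1;
  crossing_transversal : forall s t : R, 0 <= s < 1 -> 0 <= t < 1 -> s <> t ->
    shadow s = shadow t -> transversal (derive1 shadow s) (derive1 shadow t) }.

Section DiagramQuiver.
Variable D : knot_diagram.

(* The parameters at which the knot passes through a crossing. *)
Definition passage_times : set R :=
  [set t | 0 <= t < 1 /\ double_points (shadow D) (shadow D t)].

Lemma finite_passage_times : finite_set passage_times.
Proof.
apply: (@sub_finite_set _ _ (\bigcup_(c in double_points (shadow D))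
    [set t | 0 <= t < 1 /\ shadow D t = c])).
  by move=> t [t01 dt]; exists (shadow D t).
apply: bigcup_finite; first exact: finite_double_points.
move=> c [s [t [s01 t01 st sc tc]]].
apply: (@sub_finite_set _ _ [set s; t]); last exact: finite_set2.
move=> r [r01 rc].
have [] := no_triple_point r01 s01 t01 (etrans rc (esym sc)) (etrans sc (esym tc)).
- by move=> ->; left.
- by [].
- by move=> ->; right.
Qed.

Definition crossing : finType := fset_set (double_points (shadow D)).
Definition passage : finType := fset_set passage_times.

Lemma passageP (t : passage) :
  0 <= val t < 1 /\ double_points (shadow D) (shadow D (val t)).
Proof.
by have := valP t; rewrite in_fset_set ?inE //; exact: finite_passage_times.
Qed.

Lemma crossingP (e : crossing) : double_points (shadow D) (val e).
Proof.
by have := valP e; rewrite in_fset_set ?inE //; exact: finite_double_points.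
Qed.

Lemma mem_crossing (t : passage) :
  shadow D (val t) \in fset_set (double_points (shadow D)).
Proof.
by rewrite in_fset_set ?inE; [exact: (passageP t).2|exact: finite_double_points].
Qed.

Definition crossing_at (t : passage) : crossing := [` mem_crossing t]%fset.

Definition over (t : passage) : bool :=
  [exists s : passage,
    (crossing_at s == crossing_at t) && (height D (val s) < height D (val t))].

(* The passages in the order in which they occur along the diagram, to be read
   cyclically. *)
Definition passage_cycle : seq passage :=
  sort (fun s t : passage => val s <= val t) (enum passage).

Definition next_passage : passage -> passage := next passage_cycle.

(* A segment, i.e. an arrow, is represented by the passage at which it starts;
   it ends at the next passage. *)
Definition diagram_quiver : quiver :=
  {| vertex := crossing; arrow := passage;
     src := crossing_at; tgt := crossing_at \o next_passage |}.

(* [true] stands for positive. *)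
Definition source_sign (a : arrow diagram_quiver) : bool := over a.
Definition target_sign (a : arrow diagram_quiver) : bool := over (next_passage a).

Lemma over_under_exist (e : crossing) :
  (exists t, (crossing_at t == e) && over t) /\
  (exists t, (crossing_at t == e) && ~~ over t).
Proof.
have [s [t [s01 t01 st sc tc]]] := crossingP e.
wlog lt_st : s t s01 t01 st sc tc / height D s < height D t.
  move=> W; case: (ltgtP (height D s) (height D t)) => [|gt_st|eq_st].
  - exact: W s01 t01 st sc tc.
  - by apply: (W t s) => //; exact: nesym.
  - by case: st; apply: (knot_embedded s01 t01 _ eq_st); rewrite sc tc.
have hs : s \in fset_set passage_times.
  rewrite in_fset_set ?inE; last exact: finite_passage_times.
  by split=> //; rewrite sc; exact: crossingP.
have ht : t \in fset_set passage_times.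
  rewrite in_fset_set ?inE; last exact: finite_passage_times.
  by split=> //; rewrite tc; exact: crossingP.
pose s' : passage := [` hs]%fset; pose t' : passage := [` ht]%fset.
have es : crossing_at s' = e by apply: val_inj.
have et : crossing_at t' = e by apply: val_inj.
split; [exists t'|exists s'].
  by rewrite et eqxx; apply/existsP; exists s'; rewrite es et eqxx.
rewrite es eqxx; apply/existsP => -[r /andP[/eqP er lt_rs]].
have rc : shadow D (val r) = val e by exact: (congr1 val (etrans er es)).
have [] := no_triple_point (passageP r).1 s01 t01
  (etrans rc (esym sc)) (etrans sc (esym tc)).
- by move=> rs; move: lt_rs; rewrite /= rs ltxx.
- by [].
- by move=> rt; move: lt_rs; rewrite /= rt ltNge (ltW lt_st).
Qed.

Definition over_passage (e : crossing) : passage := xchoose (over_under_exist e).1.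
Definition under_passage (e : crossing) : passage := xchoose (over_under_exist e).2.

(* [arc c x y] is the part of the cycle [c] that starts with [x] and stops just
   before [y]: its first arrow is the one with source passage [x], its last
   arrow is the one with target passage [y]. *)
Definition alpha_arrows (e : crossing) : seq (arrow diagram_quiver) :=
  arc passage_cycle (over_passage e) (under_passage e).
Definition beta_arrows (e : crossing) : seq (arrow diagram_quiver) :=
  arc passage_cycle (under_passage e) (over_passage e).

Variable k : fieldType.

Local Notation kQ := (path_algebra diagram_quiver k).

Definition alpha (e : vertex diagram_quiver) : kQ := walk_elt k e (alpha_arrows e).
Definition beta (e : vertex diagram_quiver) : kQ := walk_elt k e (beta_arrows e).

Definition n_arrows : nat := #|arrow diagram_quiver|.

Definition relations_I : set kQ :=
  [set x | exists a b : arrow diagram_quiver,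
     [/\ tgt a = src b, target_sign a != source_sign b
       & x = arrow_elt k b * arrow_elt k a]].

Definition relations_II (tau : vertex diagram_quiver -> k) : set kQ :=
  [set alpha e * beta e - tau e *: (beta e * alpha e) | e in setT].

Definition relations_II' : set kQ :=
  [set path_elt k p | p in [set p : qpath diagram_quiver |
                              path_length p = n_arrows.+1]].

End DiagramQuiver.
End KnotDiagram.

Arguments alpha {R D} k e.
Arguments beta {R D} k e.
Arguments relations_I {R} D k _.
Arguments relations_II {R D k} tau _.
Arguments relations_II' {R} D k _.

(* Main.v *)
(* Modulo the type I relations a nonzero path is determined by its first arrow:
   it follows the diagram.  Such a path with n + 1 arrows, n being the number of
   arrows of the quiver, turns once around the diagram from a passage x through
   its crossing e and then takes x again: it is x beta_e alpha_e or
   x alpha_e beta_e.  The relation of type II exchanges alpha_e and beta_e up to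
   a nonzero scalar, after which x follows a segment ending with the opposite
   sign, so the path is 0.  Hence F^(n+1) lies in the ideal. *)
Require Import Defs.
From mathcomp Require Import all_boot all_order all_algebra.
From mathcomp Require Import finmap.
From mathcomp Require Import all_classical all_reals all_analysis.

Import Order.TTheory GRing.Theory Num.Theory.

Local Open Scope classical_set_scope.
Local Open Scope ring_scope.

(** The hypothesis has the three-way shape in which the absence of triple points is available. *)
Lemma card_le2 (T : finType) (P : {pred T}) :
  (forall a b c, a \in P -> b \in P -> c \in P -> [\/ a = b, b = c | a = c]) ->
  (#|P| <= 2)%N.
Proof.
move=> h; rewrite leqNgt; apply/card_gt2P => -[a [b [c [[Pa Pb Pc] [ab bc ca]]]]].
have [e|e|e] := h a b c Pa Pb Pc.
- by rewrite e eqxx in ab.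
- by rewrite e eqxx in bc.
- by rewrite e eqxx in ca.
Qed.

(** * Two-sided ideals and their powers *)

Section Ideals.
Variable A : pzRingType.
Implicit Types (I S : set A) (x y : A).

Lemma ideal_gen_ideal S : two_sided_ideal (ideal_gen S).
Proof.
split=> [I [[I0 _ _ _] _] // | x y Gx Gy | a x Gx | a x Gx] I idI;
  have [iI _] := idI.
- by apply: (idealD iI); [apply: Gx | apply: Gy].
- by apply: (idealMl iI); apply: Gx.
- by apply: (Defs.idealMr iI); apply: Gx.
Qed.

Lemma ideal_genS S : S `<=` ideal_gen S.
Proof. exact: sub_gen_smallest. Qed.

Lemma ideal_gen_sub S I : two_sided_ideal I -> S `<=` I -> ideal_gen S `<=` I.
Proof. exact: smallest_sub. Qed.

Lemma ideal_pow_ideal I n : two_sided_ideal (ideal_pow I n).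
Proof. by case: n => [|n]; [split | apply: ideal_gen_ideal]. Qed.

Lemma ideal_pow2_mul I x y : I x -> I y -> ideal_pow I 2 (x * y).
Proof.
move=> Ix Iy; apply: ideal_genS; exists x, y; split=> //.
(* The first power is generated by products of [I] with the whole ring, hence the factor 1. *)
by apply: ideal_genS; exists y, 1; rewrite mulr1.
Qed.

Lemma ideal_sub I x y :
  two_sided_ideal I -> I x -> I (x - y) -> I y.
Proof.
move=> iI Ix Ixy; rewrite -[y](subKr x).
by apply: (idealD iI) => //; rewrite -mulN1r; apply: (idealMl iI).
Qed.

End Ideals.

(** * Walks and powers of the arrow ideal *)

Section Paths.
Variables (k : fieldType) (Q : quiver).
Local Notation kQ := (path_algebra Q k).
Local Notation F := (@arrow_ideal k Q).
Implicit Types (I : set kQ) (v : vertex Q) (s : seq (arrow Q)) (p : qpath Q).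

Lemma walk_elt0 v s : ~~ composable v s -> walk_elt k v s = 0.
Proof. by move=> h; rewrite /walk_elt insubF //; apply: negbTE. Qed.

Lemma path_eltE p : path_elt k p = walk_elt k (path_src p) (path_arrows p).
Proof. by rewrite /walk_elt -surjective_pairing valK. Qed.

(** If either piece is not composable, both sides take the default value 0. The factors are reversed
    because products are read from right to left. *)
Lemma walk_cat v s1 s2 :
  walk_elt k v (s1 ++ s2) = walk_elt k (endpoint v s1) s2 * walk_elt k v s1 :> kQ.
Proof.
have [h1|h1] := boolP (composable v s1); last first.
  by rewrite (walk_elt0 _ _ h1) mulr0 walk_elt0 // composable_cat negb_and h1.
have [h2|h2] := boolP (composable (endpoint v s1) s2); last first.
  rewrite (walk_elt0 _ _ h2) mul0r walk_elt0 //.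
  by rewrite composable_cat negb_and h2 orbT.
rewrite (walk_eltE _ h1) (walk_eltE _ h2).
by rewrite [RHS]pa_mulUU /path_mul /path_tgt /= eqxx.
Qed.

Lemma walk_cons v a s :
  walk_elt k v (a :: s) = walk_elt k (tgt a) s * walk_elt k v [:: a] :> kQ.
Proof. exact: (walk_cat v [:: a]). Qed.

Lemma walk1 v a : walk_elt k v [:: a] = if src a == v then arrow_elt k a else 0.
Proof.
by case: eqP => [<- // | /eqP h]; apply: walk_elt0; rewrite /= (negbTE h).
Qed.

Lemma path_mulZl c (x y : kQ) : (c *: x) * y = c *: (x * y).
Proof. exact/esym/pa_mulZl. Qed.

Lemma path_mulZr c (x y : kQ) : x * (c *: y) = c *: (x * y).
Proof. exact/esym/pa_mulZr. Qed.

Lemma ideal_scale I c x : two_sided_ideal I -> I x -> I (c *: x).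
Proof.
by move=> iI Ix; rewrite -[x]mul1r -path_mulZl; apply: (idealMl iI).
Qed.

Lemma arrow_ideal_walk v s : s != [::] -> F (walk_elt k v s).
Proof.
have iF : two_sided_ideal F by apply: ideal_gen_ideal.
case: s => // a s _; rewrite walk_cons; apply: (idealMl iF).
rewrite walk1; case: eqP => _; last exact: (ideal0 iF).
by apply: ideal_genS; exists a.
Qed.

Lemma ideal_path_ge I n v s : two_sided_ideal I ->
  (forall p, path_length p = n -> I (path_elt k p)) ->
  (n <= size s)%N -> I (walk_elt k v s).
Proof.
move=> iI hI ns; rewrite -(cat_take_drop n s) walk_cat.
apply: (idealMl iI).
have [h|h] := boolP (composable v (take n s)); last first.
  by rewrite (walk_elt0 _ _ h); apply: (ideal0 iI).
by rewrite (walk_eltE _ h); apply: hI; rewrite /path_length /= size_takel.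
Qed.

(** Induction on [n] with [I] general: both factors of a generator of the power are reduced to ideal
    generators, an arrow and a path of length [n], whose product is a longer path or 0. *)
Lemma arrow_ideal_pow_sub I n : two_sided_ideal I ->
  (forall p, path_length p = n -> I (path_elt k p)) ->
  ideal_pow F n `<=` I.
Proof.
elim: n I => [|n IH] I iI hI.
  move=> x _; rewrite -[x]mulr1; apply: (idealMl iI).
  (* For [n = 0] all trivial paths lie in [I], and they sum to 1. *)
  rewrite -[1]/(pa_one Q k) /pa_one.
  apply: (big_ind I) => [||v _]; [exact: (ideal0 iI)|exact: (idealD iI)|].
  exact: ideal_path_ge hI _.
apply: ideal_gen_sub => // _ [x [y [Fx Gy ->]]].
(* The induction hypothesis is applied to this ideal instead of [I]. *)
pose G : set kQ :=
  ideal_gen [set path_elt k p | p in [set p | path_length p = n]].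
have iG : two_sided_ideal G by apply: ideal_gen_ideal.
have {}Gy : G y.
  by apply: IH Gy => // p np; apply: ideal_genS; exists p.
(* These [x] form a two-sided ideal because [G] absorbs left factors, so [x] may be taken to be an
   arrow. *)
suff: [set x | forall y, G y -> I (x * y)] x by apply.
apply: ideal_gen_sub Fx;
  first split=> [z _ | a b ha hb z Gz | a b hb z Gz | a b hb z Gz].
- by rewrite mul0r; apply: (ideal0 iI).
- by rewrite mulrDl; apply: (idealD iI); [apply: ha | apply: hb].
- by rewrite -mulrA; apply: (idealMl iI); apply: hb.
- by rewrite -mulrA; apply: hb; apply: (idealMl iG).
move=> _ [a _ <-] {Gy}z Gz.
(* The free factor [w] makes this set closed under left multiplication. *)
suff: [set z | forall w, I (arrow_elt k a * (w * z))] z.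
  by move=> /(_ 1); rewrite mul1r.
apply: ideal_gen_sub Gz; first split=> [w | u v hu hv w | u v hv w | u v hv w].
- by rewrite !mulr0; apply: (ideal0 iI).
- by rewrite !mulrDr; apply: (idealD iI); [apply: hu | apply: hv].
- by rewrite [w * _]mulrA; apply: hv.
- by rewrite !mulrA; apply: (Defs.idealMr iI); rewrite -mulrA; apply: hv.
move=> _ [p pn <-] w; elim/pa_ind: w => [|u v hu hv|c u hu|q].
- by rewrite mul0r mulr0; apply: (ideal0 iI).
- by rewrite mulrDl mulrDr; apply: (idealD iI).
- by rewrite path_mulZl path_mulZr; apply: ideal_scale.
rewrite [path_elt k q * _]pa_mulUU /path_mul.
case: eqP => _; last by rewrite mulr0; apply: (ideal0 iI).
set v := path_src p; set s := path_arrows p ++ _.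
have [e|e] := eqVneq (endpoint v s) (src a).
  rewrite /arrow_elt -e -walk_cat; apply: ideal_path_ge hI _ => //.
  by rewrite /s !size_cat -/(path_length p) pn addn1 ltnS leq_addr.
have [h|h] := boolP (composable v s); last first.
  by rewrite (walk_elt0 _ _ h) mulr0; apply: (ideal0 iI).
rewrite (walk_eltE _ h) /arrow_elt.
have ha : composable (src a) [:: a] by rewrite /= eqxx.
rewrite (walk_eltE _ ha) [_ * _]pa_mulUU /path_mul /path_tgt /= (negbTE e).
exact: (ideal0 iI).
Qed.

Lemma walk_pow2 v s : (1 < size s)%N ->
  ideal_pow F 2 (walk_elt k v s).
Proof.
case: s => [|a [|b s]] // _; rewrite walk_cons.
by apply: ideal_pow2_mul; apply: arrow_ideal_walk.
Qed.

End Paths.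

(** * Passages, signs and relations of type I *)

Section Diagram.
Variables (k : fieldType) (R : realType) (D : knot_diagram R).
Local Notation kQ := (path_algebra (diagram_quiver D) k).
Local Notation cyc := (passage_cycle D).
Implicit Types (a b c x y : passage D) (I : set kQ).

Lemma passage_cycle_uniq : uniq cyc.
Proof. by rewrite sort_uniq enum_uniq. Qed.

Lemma mem_passage_cycle x : x \in cyc.
Proof. by rewrite mem_sort mem_enum. Qed.

Lemma size_passage_cycle : size cyc = n_arrows D.
Proof. by rewrite size_sort -cardE. Qed.

Lemma next_passage_inj : injective (@next_passage R D).
Proof. exact: can_inj (prev_next passage_cycle_uniq). Qed.

Lemma crossing_at_shadow a b : crossing_at a = crossing_at b ->
  shadow D (val a) = shadow D (val b).
Proof. by case. Qed.

Lemma passage3 a b c : crossing_at a = crossing_at b ->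
  crossing_at b = crossing_at c -> [\/ a = b, b = c | a = c].
Proof.
move=> ab bc.
have [h|h|h] := no_triple_point (passageP a).1
  (passageP b).1 (passageP c).1
  (crossing_at_shadow _ _ ab) (crossing_at_shadow _ _ bc).
- by constructor 1; apply: val_inj.
- by constructor 2; apply: val_inj.
- by constructor 3; apply: val_inj.
Qed.

(** Heights differ because the knot is embedded. The higher passage is over; the lower one is not,
    as no third passage could lie beneath it. *)
Lemma over_neq a b : a != b -> crossing_at a = crossing_at b ->
  Defs.over a != Defs.over b.
Proof.
move=> nab eab.
wlog lt_ab : a b nab eab / height D (val a) < height D (val b).
  move=> W; case: (ltgtP (height D (val a)) (height D (val b))) => [|gt|eq].
  - exact: W.
  - by rewrite eq_sym; apply: W => //; rewrite eq_sym.
  - case/eqP: nab; apply: val_inj.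
    exact: knot_embedded (passageP a).1 (passageP b).1
      (crossing_at_shadow _ _ eab) eq.
have -> : Defs.over b by apply/existsP; exists a; rewrite eab eqxx.
rewrite eqb_id; apply/existsP => -[r /andP[/eqP er lt_ra]].
have [h|h|h] := passage3 _ _ _ er eab.
- by move: lt_ra; rewrite h ltxx.
- by rewrite h eqxx in nab.
- by move: lt_ra; rewrite h ltNge (ltW lt_ab).
Qed.

Lemma relations_I_mul a b : crossing_at (next_passage a) = crossing_at b ->
  next_passage a != b ->
  relations_I D k (arrow_elt k (b : arrow (diagram_quiver D)) *
                   arrow_elt k (a : arrow (diagram_quiver D))).
Proof. by move=> e n; exists a, b; split=> //; apply: over_neq. Qed.

(** At the first place where the list leaves the diagram, either it is not composable or two
    consecutive arrows form a type I relation. *)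
Lemma walk_fpath I e x s : two_sided_ideal I -> relations_I D k `<=` I ->
  ~~ fpath (@next_passage R D) x s ->
  I (walk_elt k (e : vertex (diagram_quiver D)) (x :: s)).
Proof.
move=> iI rI; elim: s e x => [//|y s IH] e x /=; rewrite negb_and => /orP[nxy|h].
  have [exy|exy] := eqVneq (crossing_at (next_passage x)) (crossing_at y);
    last first.
    rewrite walk_elt0; first exact: (ideal0 iI).
    by rewrite /= [crossing_at y == _]eq_sym (negbTE exy) andbF.
  rewrite walk_cons [in X in X * _]walk_cons -mulrA.
  apply: (idealMl iI).
  rewrite !walk1 /= exy eqxx.
  case: eqP => _; last by rewrite mulr0; apply: (ideal0 iI).
  by apply: rI; apply: relations_I_mul.
by rewrite walk_cons; apply: (Defs.idealMr iI); apply: IH.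
Qed.

(** * Arcs and full turns around the diagram *)

Lemma arcP x y : x != y -> exists p1 p2,
  [/\ arc cyc x y = x :: p1, arc cyc y x = y :: p2,
      fcycle (@next_passage R D) (x :: p1 ++ y :: p2)
    & size (x :: p1 ++ y :: p2) = n_arrows D].
Proof.
(* The cycle rotated to start at [x] is cut at [y] into the two arcs. *)
move=> nxy; have [i p1 p2 <- <- E] :=
  rot_to_arc passage_cycle_uniq (mem_passage_cycle x) (mem_passage_cycle y) nxy.
exists p1, p2; rewrite -E size_rot size_passage_cycle rot_cycle; split=> //.
exact: cycle_next passage_cycle_uniq.
Qed.

(** Both sides follow [next_passage] from [x] and have the same length, which determines them. *)
Lemma fpath_full x y s : x != y -> size s = n_arrows D ->
  fpath (@next_passage R D) x s ->
  x :: s = arc cyc x y ++ arc cyc y x ++ [:: x].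
Proof.
move=> nxy sn xs; have [p1 [p2 [-> -> cy sz]]] := arcP _ _ nxy.
have -> : (x :: p1) ++ (y :: p2) ++ [:: x] = x :: rcons (p1 ++ y :: p2) x.
  by rewrite -cats1 -catA.
move: cy => /fpathP [m E]; move: xs sn => /fpathP [m' ->].
move/(congr1 size): (E); rewrite /= size_rcons !size_traject.
by rewrite E -sz /= => <- ->.
Qed.

Lemma endpoint_arc x y e : x != y ->
  endpoint (e : vertex (diagram_quiver D)) (arc cyc x y) = crossing_at y.
Proof.
move=> nxy; have [p1 [p2 [-> _ cy _]]] := arcP _ _ nxy.
move: cy; rewrite /= rcons_cat cat_path /= => /and3P[_ /eqP <- _].
exact: (last_map (@tgt (diagram_quiver D)) p1 x).
Qed.

Local Notation W x y :=
  (walk_elt k (crossing_at x : vertex (diagram_quiver D)) (arc cyc x y)).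
Local Notation arr x := (arrow_elt k (x : arrow (diagram_quiver D)) : kQ).

Lemma walk_turn x y z : x != y -> crossing_at z = crossing_at x ->
  walk_elt k (crossing_at x : vertex (diagram_quiver D))
    (arc cyc x y ++ arc cyc y x ++ [:: z]) = arr z * (W y x * W x y).
Proof.
move=> nxy ezx; have nyx : y != x by rewrite eq_sym.
rewrite catA (walk_cat _ _ _ (_ ++ _)) endpoint_cat (endpoint_arc _ _ _ nyx).
by rewrite walk1 /= ezx eqxx walk_cat (endpoint_arc _ _ _ nxy).
Qed.

(* The last arrow of [arc y x ++ arc x y] ends at [y] while [x] starts with
   the opposite sign. *)
Lemma wrong_turn I x y : two_sided_ideal I -> relations_I D k `<=` I ->
  x != y -> crossing_at x = crossing_at y -> I (arr x * (W x y * W y x)).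
Proof.
move=> iI rI nxy exy.
have nyx : y != x by rewrite eq_sym.
rewrite -(walk_turn y x x nyx exy).
have [p1 [p2 [-> -> cy _]]] := arcP _ _ nxy.
apply: walk_fpath => //.
rewrite cat_path /= cat_path /= andbT.
move: cy; rewrite /= rcons_cat cat_path /= => /and3P[_ /eqP -> _].
by rewrite [y == x]eq_sym (negbTE nxy) !andbF.
Qed.

Lemma over_passageP e :
  crossing_at (@over_passage R D e) = e /\ Defs.over (over_passage e).
Proof. by have /andP[/eqP] := xchooseP (over_under_exist e).1. Qed.

Lemma under_passageP e :
  crossing_at (@under_passage R D e) = e /\ ~~ Defs.over (under_passage e).
Proof. by have /andP[/eqP] := xchooseP (over_under_exist e).2. Qed.

Lemma over_under_neq e : @over_passage R D e != under_passage e.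
Proof.
apply/eqP => E; have := (over_passageP e).2.
by rewrite E (negbTE (under_passageP e).2).
Qed.

Lemma passage_cases x :
  x = over_passage (crossing_at x) \/ x = under_passage (crossing_at x).
Proof.
have [ho _] := over_passageP (crossing_at x).
have [hu _] := under_passageP (crossing_at x).
have [h|h|h] := passage3 _ _ _ (esym ho) (etrans ho (esym hu)); auto.
by have := over_under_neq (crossing_at x); rewrite h eqxx.
Qed.

Lemma alphaE e : alpha k e = W (over_passage e) (under_passage e).
Proof. by rewrite /alpha (over_passageP e).1. Qed.

Lemma betaE e : beta k e = W (under_passage e) (over_passage e).
Proof. by rewrite /beta (under_passageP e).1. Qed.

(** Isolates the one step that needs type II: the implication assumed here exchanges the two cycles
    behind [x], and its premise is the wrong turn. *)
Lemma full_turn I x y s : two_sided_ideal I -> relations_I D k `<=` I ->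
  x != y -> crossing_at x = crossing_at y -> size s = n_arrows D ->
  (I (arr x * (W x y * W y x)) -> I (arr x * (W y x * W x y))) ->
  I (walk_elt k (crossing_at x : vertex (diagram_quiver D)) (x :: s)).
Proof.
move=> iI rI nxy exy sn h.
have [xs|xs] := boolP (fpath (@next_passage R D) x s); last exact: walk_fpath.
rewrite (fpath_full _ y _ nxy sn xs) (walk_turn _ _ _ nxy (erefl _)).
by apply: h; apply: wrong_turn.
Qed.

Lemma turn_relation (tau : vertex (diagram_quiver D) -> k) I x s :
  (forall e, tau e != 0) -> two_sided_ideal I ->
  relations_I D k `|` relations_II tau `<=` I ->
  size s = n_arrows D ->
  I (walk_elt k (crossing_at x : vertex (diagram_quiver D)) (x :: s)).
Proof.
move=> tau0 iI rI sn.
have rI1 : relations_I D k `<=` I by move=> z h; apply: rI; left.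
have rel e (a : kQ) : I (a * (alpha k e * beta k e)
                         - a * (tau e *: (beta k e * alpha k e))).
  by rewrite -mulrBr; apply: (idealMl iI); apply: rI; right; exists e.
have ou e : crossing_at (@over_passage R D e) = crossing_at (under_passage e).
  by rewrite (over_passageP e).1 (under_passageP e).1.
have [h|h] := passage_cases x; rewrite h; set e := crossing_at x.
  (* At an over-passage the wrong turn carries [alpha * beta]; the relation gives [tau e] times the
     wanted element, and [tau e] is inverted. *)
  apply: (full_turn _ _ _ _ iI rI1 (over_under_neq e) (ou e) sn).
  rewrite -alphaE -betaE => Iab.
  have := ideal_sub _ _ _ _ iI Iab (rel e _).
  move=> /(ideal_scale _ _ _ (tau e)^-1 _ iI).
  by rewrite path_mulZr scalerA (mulVf (tau0 e)) scale1r.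
have nuo : under_passage e != over_passage e by rewrite eq_sym over_under_neq.
(* At an under-passage the wrong turn carries [beta * alpha]; its [tau e] multiple is added to the
   relation. *)
apply: (full_turn _ _ _ _ iI rI1 nuo (esym (ou e)) sn).
rewrite -alphaE -betaE => Iba.
rewrite -[X in I X](subrK (arr (under_passage e) *
                           (tau e *: (beta k e * alpha k e)))).
apply: (idealD iI (rel e _)); rewrite path_mulZr.
exact: (ideal_scale _ _ _ _ _ iI Iba).
Qed.

(** * The conditions for special biserial pairs *)

Lemma card_source e : (#|[pred a : passage D | crossing_at a == e]| <= 2)%N.
Proof.
apply: card_le2 => a b c /eqP ea /eqP eb /eqP ec.
by apply: passage3; rewrite ?ea ?eb ?ec.
Qed.

Lemma card_target e :
  (#|[pred a : passage D | crossing_at (next_passage a) == e]| <= 2)%N.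
Proof.
apply: card_le2 => a b c /eqP ea /eqP eb /eqP ec.
have [/next_passage_inj h|/next_passage_inj h|/next_passage_inj h] :=
  passage3 _ _ _ (etrans ea (esym eb)) (etrans eb (esym ec)).
- by constructor 1.
- by constructor 2.
- by constructor 3.
Qed.

Lemma relations_I_pow2 :
  relations_I D k `<=` ideal_pow (@arrow_ideal k (diagram_quiver D)) 2.
Proof.
by move=> _ [a [b [_ _ ->]]]; apply: ideal_pow2_mul; apply: arrow_ideal_walk.
Qed.

Lemma relations_II_pow2 (tau : vertex (diagram_quiver D) -> k) :
  relations_II tau `<=` ideal_pow (@arrow_ideal k (diagram_quiver D)) 2.
Proof.
have iP := ideal_pow_ideal _ (@arrow_ideal k (diagram_quiver D)) 2.
move=> _ [e _ <-].
have nou := over_under_neq e.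
have [p1 [p2 [Ea Eb _ _]]] := arcP _ _ nou.
have Fa : arrow_ideal (alpha k e).
  by apply: arrow_ideal_walk; rewrite /alpha_arrows Ea.
have Fb : arrow_ideal (beta k e).
  by apply: arrow_ideal_walk; rewrite /beta_arrows Eb.
rewrite -scaleNr; apply: (idealD iP); first exact: ideal_pow2_mul.
by apply: (ideal_scale _ _ _ _ _ iP); apply: ideal_pow2_mul.
Qed.

Lemma relations_II'_pow2 :
  relations_II' D k `<=` ideal_pow (@arrow_ideal k (diagram_quiver D)) 2.
Proof.
move=> _ [p pn <-]; rewrite path_eltE; apply: walk_pow2.
move: pn; rewrite /= /path_length => pn; rewrite pn ltnS.
(* The path has an arrow, so there is at least one arrow in the quiver and its length is at least
   2. *)
case: (path_arrows p) pn => [//|a s _].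
by rewrite /n_arrows; apply/card_gt0P; exists a.
Qed.

(** Common frame for both algebras: type I relations give the local conditions, and the last
    hypothesis gives admissibility with exponent [n_arrows D + 1]. *)
Lemma special_biserial_diagram (rho : set kQ) :
  relations_I D k `<=` rho ->
  rho `<=` ideal_pow (@arrow_ideal k (diagram_quiver D)) 2 ->
  (forall p : qpath (diagram_quiver D), path_length p = (n_arrows D).+1 ->
    ideal_gen rho (path_elt k p)) ->
  special_biserial rho.
Proof.
move=> rI r2 rn; split.
- split; first exact: ideal_gen_ideal.
  exists (n_arrows D).+1; split=> //.
    by apply: arrow_ideal_pow_sub => //; apply: ideal_gen_ideal.
  by apply: ideal_gen_sub => //; apply: ideal_pow_ideal.
- exact: card_source.
- exact: card_target.
- move=> a c d ncd ec ed.
  (* At most one of [c] and [d] continues [a] along the diagram; the other forms a type I relation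
     with it. *)
  have [h|h] := eqVneq (next_passage (a : passage D)) c; last first.
    by left; apply: rI; apply: relations_I_mul => //; exact: esym.
  right; apply: rI; apply: relations_I_mul; first exact: esym.
  by rewrite h.
- move=> a b c nab ea eb.
  have [h|h] := eqVneq (next_passage (a : passage D)) c; last first.
    by left; apply: rI; apply: relations_I_mul.
  right; apply: rI; apply: relations_I_mul => //.
  (* Two different arrows cannot both precede [c] along the diagram. *)
  by apply: contraNneq nab => h'; apply/eqP/next_passage_inj; rewrite h h'.
Qed.

End Diagram.

Theorem proposition3p2 (k : fieldType) (R : realType) (D : knot_diagram R)
    (hD : double_points (shadow D) !=set0)
    (tau : vertex (diagram_quiver D) -> k) (htau : forall e, tau e != 0) :
  special_biserial (relations_I D k `|` relations_II tau) /\
  special_biserial (relations_I D k `|` relations_II' D k).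
Proof.
split; apply: special_biserial_diagram.
- exact: subsetUl.
- by rewrite subUset; split; [apply: relations_I_pow2 | apply: relations_II_pow2].
- move=> p pn; rewrite path_eltE.
  (* Composability identifies the source of [p] with the crossing of its first arrow. *)
  have := valP p; rewrite -/(path_arrows p) -/(path_src p).
  move: pn; rewrite /path_length; case: (path_arrows p) => // x s [sn].
  move=> /andP[/eqP <- _]; apply: turn_relation htau _ _ sn.
    exact: ideal_gen_ideal.
  exact: ideal_genS.
- exact: subsetUl.
- rewrite subUset; split; [exact: relations_I_pow2|exact: relations_II'_pow2].
(* In the monomial case these paths are themselves type II' relations. *)
- by move=> p pn; apply: ideal_genS; right; exists p.
Qed.
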